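(* Let $K\in L^\infty(\mathbb{R})$ with $K\le0$. Then the equation $$(-\Delta)^{\frac12}u=Ke^u\quad\text{in }\mathbb{R}$$ has no solution $u\in L_{\frac12}(\mathbb{R})$ satisfying $\int_{\mathbb{R}}e^u\,dx<\infty$.
   Context: $L_{\frac12}(\mathbb{R}):=\{u\in L^1_{\mathrm{loc}}(\mathbb{R}):\int_{\mathbb{R}}\frac{|u(x)|}{1+x^2}dx<\infty\}$ (real-valued functions). For $u\in L_{\frac12}(\mathbb{R})$, $(-\Delta)^{\frac12}u$ is the tempered distribution $\langle(-\Delta)^{\frac12}u,\varphi\rangle:=\int_{\mathbb{R}}u\,\mathcal{F}^{-1}(|\xi|\hat\varphi(\xi))\,dx$ for $\varphi$ in the Schwartz space, with $\hat\varphi(\xi)=\int_{\mathbb{R}}\varphi(x)e^{-ix\xi}dx$. The equation is in the sense of distributions. *)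

(* Defs.v *)
From mathcomp Require Import all_boot all_order all_algebra.
From mathcomp Require Import all_classical all_reals all_analysis.
From mathcomp Require Import complex.
Set Implicit Arguments.
Unset Strict Implicit.
Unset Printing Implicit Defensive.
Import Order.TTheory GRing.Theory Num.Theory.
Import numFieldNormedType.Exports.
Local Open Scope complex_scope.
Local Open Scope ring_scope.
Local Open Scope classical_set_scope.

Definition schwartz_real (R : realType) (f : R -> R) : Prop :=
  (forall (n : nat) (x : R), derivable f^`(n) x 1) /\
  (forall m n : nat, exists C : R, forall x : R, `|x ^+ m * (f^`(n))%classic x| <= C).

(* A complex-valued function of a real variable is smooth and rapidly
   decreasing, with all its derivatives, iff both its components are. *)
Definition schwartz (R : realType) (phi : R -> R[i]) : Prop :=
  schwartz_real (fun x => complex.Re (phi x)) /\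
  schwartz_real (fun x => complex.Im (phi x)).

(* [Rintegral] sends non-integrable functions to a junk value; below,
   [Cintegral] is only ever applied to functions that are integrable when
   [phi] is Schwartz, [u] is in L_{1/2}, [K] is in L^oo and e^u is in L^1. *)
Definition Cintegral (R : realType) (f : R -> R[i]) : R[i] :=
  Rintegral (@lebesgue_measure R) setT (fun x => complex.Re (f x)) +i*
  Rintegral (@lebesgue_measure R) setT (fun x => complex.Im (f x)).

Definition expi (R : realType) (t : R) : R[i] := cos t +i* sin t.

Definition fourier (R : realType) (f : R -> R[i]) (xi : R) : R[i] :=
  Cintegral (fun x => f x * expi (- (x * xi))).

(* The factor 1 / (2 pi) matches the non-unitary normalization of [fourier]. *)
Definition inv_fourier (R : realType) (g : R -> R[i]) (x : R) : R[i] :=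
  ((2 * pi)^-1)%:C * Cintegral (fun xi => g xi * expi (x * xi)).

Definition half_laplacian_schwartz (R : realType) (phi : R -> R[i]) :
    R -> R[i] :=
  inv_fourier (fun xi => `|xi|%:C * fourier phi xi).

Definition L_half (R : realType) (u : R -> R) : Prop :=
  locally_integrable [set: R] u /\
  (\int[@lebesgue_measure R]_x (`|u x| / (1 + x ^+ 2))%:E < +oo)%E.

Definition half_laplacian (R : realType) (u : R -> R) (phi : R -> R[i]) :
    R[i] :=
  Cintegral (fun x => (u x)%:C * half_laplacian_schwartz phi x).

Definition fun_distribution (R : realType) (f : R -> R) (phi : R -> R[i]) :
    R[i] :=
  Cintegral (fun x => (f x)%:C * phi x).

Definition distribution_eq (R : realType) (S T : (R -> R[i]) -> R[i]) : Prop :=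
  forall phi : R -> R[i], schwartz phi -> S phi = T phi.

(* Main.v *)
Require Import Defs.
From mathcomp Require Import all_boot all_order all_algebra.
From mathcomp Require Import all_classical all_reals all_analysis.
From mathcomp Require Import complex.
From mathcomp Require Import measurable_realfun lebesgue_integral_under ring lra.
Import Order.TTheory GRing.Theory Num.Theory.
Import numFieldNormedType.Exports.
Local Open Scope ring_scope.

(** Suppose that [u] is a solution, and write [t] for a positive scale.  The
    equation is tested against the Gaussian [exp (- x^2 / (2 t^2))].  Its half
    Laplacian is a positive multiple of
      [h_t x = \int_0^oo y exp (- t^2 y^2 / 2) cos (x y) dy = t^-2 D' (x / t)],
    where [D x = \int_0^oo exp (- y^2 / 2) sin (x y) dy] is the Dawson function,
    the solution of [D' x = 1 - x D x], [D 0 = 0] ([half_laplacian_gauss],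
    [oscX_cos_scaling]).  As [K e^u <= 0], this gives [\int u h_t <= 0] for
    every [t] ([half_laplacian_le0_kernel]).

    The kernel [w_t x = D (x / t) / x] satisfies [d/dt w_t = - h_t], so the
    average [U t = \int u w_t] is nondecreasing in [t]
    ([dawson_average_nondecreasing]); this is the substitute for the
    monotonicity in the vertical variable of the harmonic extension of [u],
    with kernels attached to Schwartz test functions in place of the Poisson
    kernels.  Moreover [0 <= w_t <= M / t], and [w_t >= d / t] on [[0, t]]
    for some [d > 0].

    Integrability of [e^u] contradicts this monotonicity.  For [s >= 0], the
    convexity inequality [u <= e^(s - 1) e^u - s] integrated against [w_t]
    yields [U t <= e^s A / t - s d] with [A] independent of [s] and [t]
    ([dawson_average_le]), a weak form of the Jensen inequality.  Taking [s]
    large and then [t] large makes the right-hand side smaller than [U 1].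

    The integrals in the Fourier transforms are folded to the half line,
    where they reduce to the integrals [osc p b c x] of
    [p y * exp (- b y^2 / 2) * cos (x y + c)], [p] a polynomial.  These are
    governed by two rules: differentiation in [x] multiplies [p] by the
    variable and shifts the phase by [pi / 2], and integration by parts
    ([osc_by_parts]). *)

(** * Integrals of functions dominated by 1 / (1 + x^2) *)

Section dominated_integrals.
Context {R : realType}.
Local Notation mu := (@lebesgue_measure R).
Local Open Scope classical_set_scope.

Lemma is_derive_continuous (F f : R -> R) :
  (forall x : R, is_derive x 1 F (f x)) -> continuous F.
Proof.
by move=> dF x; apply/differentiable_continuous/derivable1_diffP; exact: ex_derive.
Qed.

Lemma integrable_oneDsqrV :
  mu.-integrable setT (EFin \o (fun x => (oneDsqr x)^-1)).
Proof.
have mg : measurable_fun setT (fun x : R => (oneDsqr x)^-1).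
  by apply: continuous_measurable_fun; exact: continuous_oneDsqrV.
apply/integrableP; split; first exact/measurable_EFinP.
under eq_integral do rewrite gee0_abs ?lee_fin ?invr_ge0//.
rewrite (@ge0_symfun_integralT R (fun x => (oneDsqr x)^-1)).
- by rewrite -set_itvcy integral0y_oneDsqr -EFinM ltry.
- by move=> x; rewrite invr_ge0.
- exact: continuous_oneDsqrV.
- by move=> x /=; rewrite /oneDsqr sqrrN.
Qed.

Lemma integrable_dominated (D : set R) (f : R -> R) (C : R) :
  measurable D -> continuous f -> (forall x, `|f x| <= C / oneDsqr x) ->
  mu.-integrable D (EFin \o f).
Proof.
move=> mD cf fC; apply: (@integrableS _ _ _ mu setT) => //.
have := integrableZl measurableT C integrable_oneDsqrV.
apply: le_integrable => //.
  by apply/measurable_EFinP; exact: continuous_measurable_fun.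
move=> x _ /=; rewrite lee_fin (le_trans (fC x))//.
exact: ler_norm.
Qed.

Lemma integrable_scale (D : set R) (k : R) (f : R -> R) : measurable D ->
  mu.-integrable D (EFin \o f) -> mu.-integrable D (EFin \o (fun x => k * f x)).
Proof.
by move=> mD fi; have := @integrableZl _ _ _ mu D mD k _ fi; apply: eq_integrable.
Qed.

Lemma ge0_integralT_fold (f : R -> R) : (forall x, 0 <= f x) -> continuous f ->
  (\int[mu]_x (f x)%:E = \int[mu]_(x in `[0%R, +oo[) (f x)%:E +
    \int[mu]_(x in `[0%R, +oo[) (f (- x))%:E)%E.
Proof.
move=> f0 cf.
have mf : measurable_fun [set: R] f by exact: continuous_measurable_fun.
rewrite -(setUv `[0%R, +oo[%classic) ge0_integral_setU//= ; last 4 first.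
  exact: measurableC.
  by apply/measurable_EFinP; rewrite setUv.
  by move=> x _; rewrite lee_fin.
  exact/disj_setPCl.
congr +%E; rewrite setCitvr.
rewrite integral_itv_bndo_bndc; last exact/measurable_EFinP/measurable_funTS.
by rewrite -{1}oppr0 ge0_integration_by_substitutionNy//; exact: continuous_subspaceT.
Qed.

(** Folding the line at the origin; an odd part of the integrand cancels. *)
Lemma Rintegral_fold (f : R -> R) (C : R) :
  continuous f -> (forall x, `|f x| <= C / oneDsqr x) ->
  \int[mu]_x (f x) = \int[mu]_(x in `[0%R, +oo[) (f x + f (- x)).
Proof.
move=> cf fC.
have cN (h : R -> R) : continuous h -> continuous (fun x => h (- x)).
  by move=> ch x; apply: (@continuous_comp _ _ _ -%R h); [exact: opp_continuous|exact: ch].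
have fNC x : `|f (- x)| <= C / oneDsqr x.
  by rewrite (le_trans (fC _))// /oneDsqr sqrrN.
pose g (x : R) : R := C / oneDsqr x.
have C0 : 0 <= C.
  by have := le_trans (normr_ge0 _) (fC 0); rewrite /oneDsqr expr0n/= addr0 invr1 mulr1.
have cg : continuous g.
  by move=> x; apply: cvgM; [exact: cvg_cst|exact: continuous_oneDsqrV].
have gg x : `|g x| <= C / oneDsqr x by rewrite ger0_norm// divr_ge0.
have iD (h : R -> R) D : measurable D -> continuous h ->
    (forall x, `|h x| <= C / oneDsqr x) -> mu.-integrable D (EFin \o h).
  by move=> mD ch hC; exact: (integrable_dominated _ _ C).
have iDD (h k : R -> R) D : measurable D -> mu.-integrable D (EFin \o h) ->
    mu.-integrable D (EFin \o k) -> mu.-integrable D (EFin \o (fun x => h x + k x)).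
  move=> mD ih ik.
  by have := integrableD mD ih ik; apply: eq_integrable.
have fold0 (h : R -> R) : (forall x, 0 <= h x) -> continuous h ->
    mu.-integrable setT (EFin \o h) ->
    mu.-integrable `[0%R, +oo[ (EFin \o (fun x => h (- x))) ->
    \int[mu]_x (h x) = \int[mu]_(x in `[0%R, +oo[) h x + \int[mu]_(x in `[0%R, +oo[) h (- x).
  move=> h0 ch ih ihN; rewrite /Rintegral ge0_integralT_fold// fineD//.
  - by apply: integrable_fin_num => //; exact: integrableS ih.
  - exact: integrable_fin_num.
have k0 x : 0 <= f x + g x.
  by rewrite -lerBlDr sub0r; move: (fC x); rewrite ler_norml => /andP[].
have igT := iD g setT measurableT cg gg.
have ifT := iD f setT measurableT cf fC.
have mI : measurable (`[0%R, +oo[%classic : set R) by [].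
have ig := iD g _ mI cg gg.
have if_ := iD f _ mI cf fC.
have ifN := iD _ _ mI (cN _ cf) fNC.
have gN x : g (- x) = g x by rewrite /g /oneDsqr sqrrN.
have igN : mu.-integrable `[0%R, +oo[ (EFin \o (fun x => g (- x))).
  by rewrite (_ : (fun x => _) = g) //; apply/funext.
(* The nonnegative case applies to [f + g] and to [g], as [|f| <= g]. *)
have := fold0 (fun x => f x + g x) k0.
rewrite !RintegralD// (fold0 g)//; last by move=> x; rewrite divr_ge0.
have cfg : continuous (fun x => f x + g x).
  by move=> x; apply: cvgD; [exact: cf|exact: cg].
move=> /(_ cfg (iDD _ _ _ measurableT ifT igT) (iDD _ _ _ mI ifN igN)).
by rewrite [X in _ = X]addrACA => /addIr.
Qed.

(** The fundamental theorem of calculus on the half line, for a derivative of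
    any sign: [f + C / (1 + x^2)] is nonnegative, with primitive [F + C atan]. *)
Lemma Rintegral_FTC (F f : R -> R) (C l : R) :
  continuous f -> (forall x, `|f x| <= C / oneDsqr x) ->
  (forall x : R, is_derive x 1 F (f x)) -> F x @[x --> +oo] --> l ->
  \int[mu]_(x in `[0%R, +oo[) f x = l - F 0.
Proof.
move=> cf fC dF Fl.
pose g (x : R) : R := C / oneDsqr x.
have C0 : 0 <= C.
  by have := le_trans (normr_ge0 _) (fC 0); rewrite /oneDsqr expr0n/= addr0 invr1 mulr1.
have cg : continuous g.
  by move=> x; apply: cvgM; [exact: cvg_cst|exact: continuous_oneDsqrV].
have gg x : `|g x| <= C / oneDsqr x by rewrite ger0_norm// divr_ge0.
have k0 x : 0 <= f x + g x.
  by rewrite -lerBlDr sub0r; move: (fC x); rewrite ler_norml => /andP[].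
have mI : measurable (`[0%R, +oo[%classic : set R) by [].
have ig := integrable_dominated _ g C mI cg gg.
have if_ := integrable_dominated _ f C mI cf fC.
have FTC (G h : R -> R) (m : R) : (forall x, 0 <= h x) -> continuous h ->
    (forall x : R, is_derive x 1 G (h x)) -> G x @[x --> +oo] --> m ->
    \int[mu]_(x in `[0%R, +oo[) h x = m - G 0.
  move=> h0 ch dG Gm; apply: Rintegral_ge0_continuous_FTC2y => //.
  - exact: continuous_subspaceT.
  - by apply: cvg_at_right_filter; exact: (is_derive_continuous G h).
  - by move=> x _; rewrite derive1E; case: (dG x).
have dA (x : R) : is_derive x 1 (fun x => C * atan x) (g x).
  by apply: is_derive_eq; rewrite /g /oneDsqr.
have := FTC (fun x => F x + C * atan x) (fun x => f x + g x) (l + C * (pi / 2)) k0.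
rewrite RintegralD// (FTC (fun x => C * atan x) g (C * (pi / 2)))//; last 2 first.
- by move=> x; rewrite divr_ge0.
- by apply: cvgM; [exact: cvg_cst|exact: cvgy_atan].
have cfg : continuous (fun x => f x + g x).
  by move=> x; apply: cvgD; [exact: cf|exact: cg].
have dFA (x : R) : is_derive x 1 (fun x => F x + C * atan x) (f x + g x).
  exact: is_deriveD.
have FAl : F x + C * atan x @[x --> +oo] --> l + C * (pi / 2).
  by apply: cvgD => //; apply: cvgM; [exact: cvg_cst|exact: cvgy_atan].
move=> /(_ cfg dFA FAl); rewrite atan0 mulr0 subr0 addr0 => H.
by apply: (addIr (C * (pi / 2))); rewrite H addrAC.
Qed.

(** Differentiation under the integral sign, in the form of [is_derive]. *)
Lemma is_derive_under_integral (D : set R) (f df : R -> R -> R) (a u v : R)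
    (g : R -> R) : measurable D -> u < a < v ->
  (forall x, u < x < v -> mu.-integrable D (EFin \o f x)) ->
  (forall x y : R, u < x < v -> is_derive x 1 (f ^~ y) (df x y)) ->
  (forall y, 0 <= g y) -> mu.-integrable D (EFin \o g) ->
  (forall x y, u < x < v -> `|df x y| <= g y) ->
  is_derive a 1 (fun x => \int[mu]_(y in D) f x y) (\int[mu]_(y in D) df a y).
Proof.
move=> mD auv intf dfE g0 intg dfg.
have I x : `]u, v[%classic x -> u < x < v by rewrite /= in_itv.
have Ia : `]u, v[%classic a by rewrite /= in_itv.
have d1E x y : u < x < v -> partial1of2 f x y = df x y.
  by move=> xuv; rewrite partial1of2E; case: (dfE x y xuv).
apply: DeriveDef.
  apply: (@derivable_under_integral R _ _ mu f D mD a u v Ia _ _ g) => //.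
  - by move=> x y Ix _; case: (dfE x y (I _ Ix)).
  - by move=> x y Ix _; have xuv := I _ Ix; rewrite d1E//; exact: dfg.
rewrite -derive1E (@differentiation_under_integral R _ _ mu f D mD a u v Ia _ _ g) //.
  - by apply: eq_Rintegral => y _; rewrite d1E.
  - by move=> x y Ix _; case: (dfE x y (I _ Ix)).
  - by move=> x y Ix _; have xuv := I _ Ix; rewrite d1E//; exact: dfg.
Qed.

End dominated_integrals.

(** * Polynomials times Gaussians *)

Section polynomial_gaussians.
Context {R : realType}.
Local Open Scope classical_set_scope.
Implicit Types (p q : {poly R}) (b x : R).

(** The function [p x * exp (- b x^2 / 2)]. *)
Definition pgauss p b x : R := p.[x] * expR (- (b / 2 * x ^+ 2)).

(** The polynomial factor of the derivative of [pgauss p b]. *)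
Definition dpgauss p b : {poly R} := (p^`() - b *: ('X * p))%R.

Lemma is_derive_pgauss p b x : is_derive x 1 (pgauss p b) (pgauss (dpgauss p b) b x).
Proof.
rewrite /pgauss /dpgauss.
have dG : is_derive x 1 (fun x => expR (- (b / 2 * x ^+ 2)))
    (expR (- (b / 2 * x ^+ 2)) * (- (b * x))).
  apply: (@is_derive1_comp _ expR (fun x => - (b / 2 * x ^+ 2)) x).
  by apply: is_derive_eq; rewrite /GRing.scale /=; field.
by apply: is_derive_eq; rewrite /GRing.scale /=
  !(hornerD, hornerN, hornerZ, hornerM, hornerX); ring.
Qed.

Lemma derive1_pgauss p b : (pgauss p b)^`() = pgauss (dpgauss p b) b.
Proof.
by apply/funext => x; rewrite derive1E; case: (is_derive_pgauss p b x).
Qed.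

Lemma derive1n_pgauss p b n :
  (pgauss p b)^`(n) = pgauss (iter n (fun q => dpgauss q b) p) b.
Proof.
elim: n => [|n IH]; first by rewrite derive1n0.
by rewrite derive1nS IH derive1_pgauss.
Qed.

Lemma continuous_pgauss p b : continuous (pgauss p b).
Proof. exact: (is_derive_continuous _ _ (is_derive_pgauss p b)). Qed.

Lemma oneDsqr_gauss_bounded b (n : nat) : 0 < b ->
  exists C, forall x, oneDsqr x ^+ n * expR (- (b / 2 * x ^+ 2)) <= C.
Proof.
move=> b0; exists ((2 / b) ^+ n * n`!%:R * expR (b / 2)) => x.
(* With [z = b / 2 * (1 + x^2)], the bound is [z^n <= n! e^z]. *)
pose z := b / 2 * oneDsqr x.
have z0 : 0 <= z by rewrite mulr_ge0// ltW// divr_gt0.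
have zn : z ^+ n / n`!%:R <= expR z.
  case: n => [|n]; first by rewrite expr0 fact0 divr1 (le_trans _ (expR_ge1Dx z))// lerDl.
  by apply: (le_trans _ (expR_ge1Dxn n z0)); rewrite lerDr.
have -> : expR (- (b / 2 * x ^+ 2)) = expR (b / 2) * expR (- z).
  by rewrite -expRD /z /oneDsqr; congr expR; ring.
have -> : oneDsqr x ^+ n = (2 / b) ^+ n * z ^+ n.
  by rewrite -exprMn /z; congr (_ ^+ _); field; rewrite gt_eqF.
rewrite mulrACA [leRHS]mulrAC.
rewrite ler_pM2l ?mulr_gt0 ?exprn_gt0 ?divr_gt0 ?expR_gt0//.
by rewrite expRN ler_pdivrMr ?expR_gt0// [leRHS]mulrC -ler_pdivrMr ?ltr0n ?fact_gt0.
Qed.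

Lemma horner_le_oneDsqr p : exists C n, 0 <= C /\ forall x, `|p.[x]| <= C * oneDsqr x ^+ n.
Proof.
elim/poly_ind: p => [|p c [C [n [C0 IH]]]].
  by exists 0, 0%N; split => // x; rewrite horner0 normr0 mul0r.
exists (C + `|c|), n.+1; split; first by rewrite addr_ge0.
move=> x; rewrite !hornerE (le_trans (ler_normD _ _))// mulrDl lerD//.
  rewrite normrM exprSr mulrA ler_pM//.
  rewrite /oneDsqr; have := real_normK (num_real x) => <-.
  by have := sqr_ge0 (`|x| - 1); nra.
by rewrite ler_peMr// exprn_ege1.
Qed.

Lemma pgauss_bounded p b : 0 < b -> exists C, forall x, `|pgauss p b x| <= C.
Proof.
move=> b0; have [C [n [C0 pC]]] := horner_le_oneDsqr p.
have [M xM] := oneDsqr_gauss_bounded b n b0.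
exists (C * M) => x; rewrite /pgauss normrM (ger0_norm (expR_ge0 _)).
apply: (le_trans (ler_wpM2r (expR_ge0 _) (pC x))); by rewrite -(mulrA C) ler_wpM2l.
Qed.

Lemma schwartz_pgauss p b : 0 < b -> schwartz_real (pgauss p b).
Proof.
move=> b0; split=> [n x|m n]; rewrite derive1n_pgauss.
  by case: (is_derive_pgauss (iter n (fun q => dpgauss q b) p) b x).
set q := iter _ _ _.
have [C HC] := pgauss_bounded ('X^m * q) b b0.
by exists C => x; move: (HC x); rewrite /pgauss hornerM hornerXn (mulrA (x ^+ m)).
Qed.

Lemma pgauss_decay p b : 0 < b -> exists C, forall x, `|pgauss p b x| <= C / oneDsqr x.
Proof.
move=> b0; have [C HC] := pgauss_bounded ((1 + 'X^2) * p) b b0.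
exists C => x; move: (HC x); rewrite /pgauss ler_pdivlMr ?(lt_le_trans ltr01)//.
rewrite !hornerE -/(oneDsqr x) => H.
rewrite -[X in _ * X]ger0_norm ?(le_trans ler01)// -normrM.
by rewrite mulrC mulrA.
Qed.

Lemma oneDsqr_gt0 x : 0 < oneDsqr x. Proof. by rewrite (lt_le_trans ltr01). Qed.

(** Decay at infinity, in the form of the boundary term of an integration by
    parts against a bounded factor. *)
Lemma cvg_pgauss_mul p b (t : R -> R) : 0 < b -> (forall x, `|t x| <= 1) ->
  pgauss p b x * t x @[x --> +oo] --> (0 : R).
Proof.
move=> b0 t1; have [C HC] := pgauss_bounded (('X) * p) b b0.
have C0 : 0 <= C by exact: le_trans (HC 0).
apply/cvgr0Pnorm_le => e e0; near=> x.
have x0 : 0 < x by near: x; exact: nbhs_pinfty_gt.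
rewrite normrM (@le_trans _ _ `|pgauss p b x|)// ?ler_piMr//.
move: (HC x); rewrite /pgauss hornerM hornerX -(mulrA x) normrM (gtr0_norm x0) => H.
rewrite -(ler_pM2l x0) (le_trans H)// -ler_pdivrMr//.
Unshelve. all: end_near. Qed.

End polynomial_gaussians.

(** * Cosine integrals of polynomial Gaussians on the half line *)

Section oscillatory_integrals.
Context {R : realType}.
Local Notation mu := (@lebesgue_measure R).
Local Open Scope classical_set_scope.
Implicit Types (p q : {poly R}) (b t x y : R).

(** The phase [t] covers both trigonometric transforms: phase [0] is the cosine
    transform and phase [- (pi / 2)] the sine transform. *)
Definition osc p b t x : R :=
  \int[mu]_(y in `[0%R, +oo[) (pgauss p b y * cos (x * y + t)).

Lemma normr_cos_le1 x : `|cos x| <= 1.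
Proof. by rewrite ler_norml cos_geN1 cos_le1. Qed.

Lemma continuous_pgauss_cos p b t x :
  continuous (fun y => pgauss p b y * cos (x * y + t)).
Proof.
move=> y; apply: cvgM; first exact: continuous_pgauss.
apply: (@continuous_comp _ _ _ (fun y => x * y + t) cos).
  by apply: cvgD; [apply: cvgM; [exact: cvg_cst|exact: cvg_id]|exact: cvg_cst].
exact: continuous_cos.
Qed.

Lemma normr_pgauss_cos_le p b t x y :
  `|pgauss p b y * cos (x * y + t)| <= `|pgauss p b y|.
Proof. by rewrite normrM ler_piMr// normr_cos_le1. Qed.

Lemma integrable_pgauss_cos p b t x : 0 < b ->
  mu.-integrable `[0%R, +oo[ (EFin \o (fun y => pgauss p b y * cos (x * y + t))).
Proof.
move=> b0; have [C HC] := pgauss_decay p b b0.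
apply: (integrable_dominated _ _ C) => //; first exact: continuous_pgauss_cos.
by move=> y; rewrite (le_trans (normr_pgauss_cos_le _ _ _ _ _)).
Qed.

Lemma osc_bounded p b : 0 < b -> exists C, forall t x, `|osc p b t x| <= C.
Proof.
move=> b0; exists (\int[mu]_(y in `[0%R, +oo[) `|pgauss p b y|) => t x.
have ip := integrable_pgauss_cos p b t x b0.
rewrite (le_trans (le_normr_Rintegral _ ip))//.
apply: le_Rintegral => //.
- exact: integrable_norm.
- apply: integrable_norm.
  have := integrable_pgauss_cos p b 0 0 b0; apply: eq_integrable => //.
  by move=> y _ /=; rewrite mul0r addr0 cos0 mulr1.
- by move=> y _; exact: normr_pgauss_cos_le.
Qed.

Lemma is_derive_osc p b t x : 0 < b ->
  is_derive x 1 (osc p b t) (osc ('X * p) b (t + pi / 2) x).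
Proof.
move=> b0; have [C HC] := pgauss_decay ('X * p) b b0.
have C0 : 0 <= C.
  by have := le_trans (normr_ge0 _) (HC 0); rewrite /oneDsqr expr0n/= addr0 invr1 mulr1.
pose g y := C / oneDsqr y.
apply: (is_derive_under_integral _ (fun x y => pgauss p b y * cos (x * y + t))
   (fun x y => pgauss ('X * p) b y * cos (x * y + (t + pi / 2)))
   x (x - 1) (x + 1) g) => //.
- by rewrite ltrDl ltrBlDr ltrDl ltr01.
- by move=> z _; exact: integrable_pgauss_cos.
- move=> z y _; rewrite addrA cosDpihalf.
  have dc : is_derive z 1 (fun z => cos (z * y + t)) (- sin (z * y + t) * y).
    apply: (@is_derive1_comp _ cos (fun z => z * y + t) z).
    by apply: is_derive_eq; rewrite /GRing.scale /=; ring.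
  apply: is_derive_eq; rewrite /pgauss hornerM hornerX /GRing.scale /=; ring.
- by move=> y; rewrite divr_ge0.
- apply: (integrable_dominated _ g C) => //.
    by move=> y; apply: cvgM; [exact: cvg_cst|exact: continuous_oneDsqrV].
  by move=> y; rewrite ger0_norm// divr_ge0.
- by move=> z y _; rewrite (le_trans (normr_pgauss_cos_le _ _ _ _ _)).
Qed.

Lemma osc_by_parts p b t x : 0 < b ->
  osc (dpgauss p b) b t x + x * osc p b (t + pi / 2) x = - (p.[0] * cos t).
Proof.
move=> b0; have i1 := integrable_pgauss_cos (dpgauss p b) b t x b0.
have i2 := integrable_pgauss_cos p b (t + pi / 2) x b0.
rewrite /osc -RintegralZl// -RintegralD//; last exact: integrable_scale.
have [C1 HC1] := pgauss_decay (dpgauss p b) b b0.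
have [C2 HC2] := pgauss_decay p b b0.
transitivity (0 - pgauss p b 0 * cos (x * 0 + t)); last first.
  by rewrite sub0r mulr0 add0r /pgauss expr0n/= mulr0 oppr0 expR0 mulr1.
apply: (Rintegral_FTC (fun y => pgauss p b y * cos (x * y + t)) _
  (C1 + `|x| * C2) 0).
- move=> y; apply: cvgD; first exact: continuous_pgauss_cos.
  by apply: cvgM; [exact: cvg_cst|exact: continuous_pgauss_cos].
- move=> y; apply: (le_trans (ler_normD _ _)); rewrite [leRHS]mulrDl; apply: lerD.
    by rewrite (le_trans (normr_pgauss_cos_le _ _ _ _ _)).
  rewrite normrM -[leRHS]mulrA ler_wpM2l//.
  by rewrite (le_trans (normr_pgauss_cos_le _ _ _ _ _)).
- move=> y; rewrite addrA cosDpihalf.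
  have dp := is_derive_pgauss p b y.
  have dc : is_derive y 1 (fun y => cos (x * y + t)) (- sin (x * y + t) * x).
    apply: (@is_derive1_comp _ cos (fun y => x * y + t) y).
    by apply: is_derive_eq; rewrite /GRing.scale /=; ring.
  by apply: is_derive_eq; rewrite /GRing.scale /=; ring.
- by apply: cvg_pgauss_mul => // y; exact: normr_cos_le1.
Qed.

Lemma oscDpi p b t x : 0 < b -> osc p b (t + pi) x = - osc p b t x.
Proof.
move=> b0; rewrite -mulN1r /osc -RintegralZl//; last exact: integrable_pgauss_cos.
by apply: eq_Rintegral => y _; rewrite addrA cosDpi mulrN mulN1r.
Qed.

Lemma oscZ p b t x c : 0 < b -> osc (c *: p) b t x = c * osc p b t x.
Proof.
move=> b0; rewrite /osc -RintegralZl//; last exact: integrable_pgauss_cos.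
by apply: eq_Rintegral => y _; rewrite /pgauss hornerZ !mulrA.
Qed.

Lemma dpgauss1 b : dpgauss 1 b = (- b) *: 'X :> {poly R}.
Proof. by rewrite /dpgauss -polyC1 derivC polyC1 mulr1 sub0r scaleNr. Qed.

Lemma is_derive_osc1_cos b x : 0 < b ->
  is_derive x 1 (osc 1 b 0) (- (x / b) * osc 1 b 0 x).
Proof.
move=> b0; have := is_derive_osc 1 b 0 x b0.
have := osc_by_parts 1 b (pi / 2) x b0.
rewrite dpgauss1 oscZ// (_ : pi / 2 + pi / 2 = 0 + pi :> R); last by field.
rewrite oscDpi// cos_pihalf mulr0 oppr0 add0r mulr1 => H.
suff -> : osc 'X b (pi / 2) x = - (x / b) * osc 1 b 0 x by [].
have bN : b != 0 by rewrite gt_eqF.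
apply: (mulfI bN); rewrite (_ : b * (- (x / b) * _) = - (x * osc 1 b 0 x)); last by field.
by lra.
Qed.

(** The cosine transform of a Gaussian is a Gaussian, by uniqueness for the
    differential equation of [is_derive_osc1_cos]. *)
Lemma osc1_cosE b x : 0 < b ->
  osc 1 b 0 x = osc 1 b 0 0 * expR (- (b^-1 / 2 * x ^+ 2)).
Proof.
move=> b0; have bN : b != 0 by rewrite gt_eqF.
pose E y : R := expR (b^-1 / 2 * y ^+ 2).
have dE y : is_derive y 1 E (E y * (y / b)).
  apply: (@is_derive1_comp _ expR (fun y => b^-1 / 2 * y ^+ 2) y).
  by apply: is_derive_eq; rewrite /GRing.scale /=; field.
have H : osc 1 b 0 x * E x = osc 1 b 0 0 * E 0.
  apply: (@is_derive_0_is_cst R (fun y => osc 1 b 0 y * E y)) => y.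
  have d1 := is_derive_osc1_cos b y b0.
  by apply: is_derive_eq; rewrite /GRing.scale /=; ring.
rewrite expRN; apply: (canRL (mulfK _)); first by rewrite gt_eqF ?expR_gt0.
by rewrite -/(E x) H /E expr0n /= mulr0 expR0 mulr1.
Qed.

Lemma is_derive_osc1_sin b x : 0 < b ->
  is_derive x 1 (osc 1 b (- (pi / 2))) (osc 'X b 0 x).
Proof.
by move=> b0; have := is_derive_osc 1 b (- (pi / 2)) x b0; rewrite addNr mulr1.
Qed.

(** With [S] the sine transform of the Gaussian, this is the differential
    equation [b S' = 1 - x S]. *)
Lemma oscX_cosE b x : 0 < b ->
  b * osc 'X b 0 x = 1 - x * osc 1 b (- (pi / 2)) x.
Proof.
move=> b0; have := osc_by_parts 1 b 0 x b0.
rewrite dpgauss1 oscZ// add0r cos0 mulr1 -{1}polyC1 hornerC.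
rewrite {1}(_ : pi / 2 = - (pi / 2) + pi :> R); last by field.
by rewrite oscDpi// => H; lra.
Qed.

(** Two integrations by parts extract the factor [1 / x^2]. *)
Lemma oscX_cos_decay b : 0 < b ->
  exists C, forall x, `|osc 'X b 0 x| <= C / oneDsqr x.
Proof.
move=> b0; have [C1 HC1] := osc_bounded 'X b b0.
have [C2 HC2] := osc_bounded (dpgauss (dpgauss 'X b) b) b b0.
exists (C1 + (1 + C2)) => x; rewrite ler_pdivlMr ?oneDsqr_gt0//.
rewrite -[X in _ * X]gtr0_norm ?oneDsqr_gt0// -normrM /oneDsqr mulrDr mulr1.
rewrite (le_trans (ler_normD _ _))// lerD//.
have H1 := osc_by_parts 'X b (- (pi / 2)) x b0.
have H2 := osc_by_parts (dpgauss 'X b) b (- pi) x b0.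
have q0 : (dpgauss 'X b).[0] = 1.
  rewrite /dpgauss derivX hornerD hornerN hornerZ hornerM hornerX -polyC1 hornerC.
  by rewrite mul0r mulr0 subr0.
have E1 : osc 'X b 0 x * x ^+ 2 = - 1 + osc (dpgauss (dpgauss 'X b) b) b (- pi) x.
  move: H1 H2; rewrite addNr (_ : - pi + pi / 2 = - (pi / 2) :> R); last by field.
  rewrite (cosN pi) cospi hornerX mul0r oppr0 q0 mul1r opprK.
  set A := osc _ _ (- (pi / 2)) _; set B := osc 'X _ _ _; set D := osc _ _ (- pi) _.
  move=> H1 H2; have -> : D = 1 - x * A by rewrite -H2 addrK.
  have -> : A = - (x * B) by apply/eqP; rewrite -addr_eq0 H1.
  by ring.
rewrite E1 (le_trans (ler_normD _ _))// normrN normr1 lerD//.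
Qed.

End oscillatory_integrals.

(** * The half Laplacian of a Gaussian *)

Section gaussian_half_laplacian.
Context {R : realType}.
Local Notation mu := (@lebesgue_measure R).
Local Open Scope classical_set_scope.
Implicit Types (a b t x : R).

Lemma integrable_indic0 t : mu.-integrable setT (EFin \o (\1_`[0%R, t] : R -> R)).
Proof. exact: integrable_indic_itv. Qed.

Lemma Rintegral_indic0 t : 0 <= t -> \int[mu]_x (\1_`[0%R, t] x : R) = t.
Proof.
move=> t0; rewrite /Rintegral integral_indic// setIT.
suff mt : lebesgue_measure `[0%R, t]%classic = t%:E by exact: (congr1 fine mt).
rewrite lebesgue_measure_itv /= lte_fin.
by case: ltP => [_|t0']; rewrite ?sube0//; congr EFin; apply/eqP; rewrite eq_le t0 t0'.
Qed.

(** The integral of [exp (- a x^2 / 2)]; only its positivity matters. *)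
Definition gauss_mass a : R := \int[mu]_x pgauss 1 a x.

Lemma pgauss1E a x : pgauss 1 a x = expR (- (a / 2 * x ^+ 2)).
Proof. by rewrite /pgauss -polyC1 hornerC mul1r. Qed.

Lemma pgauss1N a x : pgauss 1 a (- x) = pgauss 1 a x.
Proof. by rewrite !pgauss1E sqrrN. Qed.

Lemma gauss_mass_gt0 a : 0 < a -> 0 < gauss_mass a.
Proof.
move=> a0; have [C HC] := pgauss_decay 1 a a0.
have ip : mu.-integrable setT (EFin \o pgauss 1 a).
  by apply: (integrable_dominated _ _ C) => //; exact: continuous_pgauss.
apply: (@lt_le_trans _ _ (\int[mu]_x (expR (- (a / 2)) * \1_`[0%R, 1%R] x))).
  by rewrite RintegralZl ?integrable_indic0// Rintegral_indic0// mulr1 expR_gt0.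
apply: le_Rintegral => //; first exact: integrable_scale (integrable_indic0 1).
move=> x _; rewrite pgauss1E indicE; case: (boolP (x \in _)) => xin;
  rewrite ?mulr0 ?expR_ge0// mulr1.
rewrite ler_expR lerN2 ler_piMr ?divr_ge0 ?(ltW a0)//.
by move: xin; rewrite inE /= in_itv /= => /andP[x0 x1]; rewrite expr_le1.
Qed.

Lemma fourier_gauss a xi : 0 < a ->
  fourier (fun x => (pgauss 1 a x)%:C%C) xi = (gauss_mass a * pgauss 1 a^-1 xi)%:C%C.
Proof.
move=> a0; have [C HC] := pgauss_decay 1 a a0.
have cosb (th : R -> R) x : `|th x| <= 1 -> `|pgauss 1 a x * th x| <= C / oneDsqr x.
  by move=> h; rewrite (le_trans _ (HC x))// normrM ler_piMr.
have cN z : continuous (fun x => - (x * z)).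
  by move=> x; apply: cvgN; apply: cvgM; [exact: cvg_id|exact: cvg_cst].
have cc z : continuous (fun x => pgauss 1 a x * cos (- (x * z))).
  move=> x; apply: cvgM; first exact: continuous_pgauss.
  by apply: (@continuous_comp _ _ _ (fun x => - (x * z)) cos);
    [exact: cN|exact: continuous_cos].
have cs : continuous (fun x => pgauss 1 a x * sin (- (x * xi))).
  move=> x; apply: cvgM; first exact: continuous_pgauss.
  by apply: (@continuous_comp _ _ _ (fun x => - (x * xi)) sin);
    [exact: cN|exact: continuous_sin].
have foldc z : \int[mu]_x (pgauss 1 a x * cos (- (x * z))) = 2 * osc 1 a 0 z.
  rewrite (Rintegral_fold _ C (cc z)); last first.
    by move=> x; apply: (cosb (fun x => cos (- (x * z)))); exact: normr_cos_le1.
  rewrite /osc -RintegralZl//; last exact: integrable_pgauss_cos.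
  apply: eq_Rintegral => x _; rewrite pgauss1N mulNr !cosN addr0 (mulrC x); ring.
rewrite /fourier /Cintegral /expi /=; congr Complex.
  under eq_Rintegral do rewrite mul0r subr0.
  rewrite foldc osc1_cosE// mulrA -foldc pgauss1E; congr (_ * _).
  by apply: eq_Rintegral => x _; rewrite mulr0 oppr0 cos0 mulr1.
under eq_Rintegral do rewrite mul0r addr0.
(* The imaginary part is the integral of an odd function. *)
rewrite (Rintegral_fold (fun x => pgauss 1 a x * sin (- (x * xi))) C cs); last first.
  by move=> x; apply: (cosb (fun x => sin (- (x * xi)))); rewrite ler_norml sin_geN1 sin_le1.
rewrite (_ : (fun x => _) = cst 0) ?Rintegral_cst ?mul0r//.
by apply/funext => x; rewrite pgauss1N mulNr !opprK sinN /cst; ring.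
Qed.

(** The positive constant of [half_laplacian_gauss]; the factor [2] comes from
    folding the line. *)
Definition half_laplacian_const a := (2 * pi)^-1 * (gauss_mass a * 2).

Lemma half_laplacian_gauss a x : 0 < a ->
  complex.Re (half_laplacian_schwartz (fun x => (pgauss 1 a x)%:C%C) x) =
  half_laplacian_const a * osc 'X a^-1 0 x.
Proof.
move=> a0; have b0 : 0 < a^-1 by rewrite invr_gt0.
have [C HC] := pgauss_decay 'X a^-1 b0.
rewrite /half_laplacian_schwartz.
have -> : (fun xi : R => `|xi|%:C%C * fourier (fun x => (pgauss 1 a x)%:C%C) xi) =
    (fun xi : R => (`|xi| * (gauss_mass a * pgauss 1 a^-1 xi))%:C%C).
  by apply/funext => xi; rewrite fourier_gauss// -rmorphM.
rewrite /inv_fourier /Cintegral /= mul0r subr0 /half_laplacian_const -mulrA; congr (_ * _).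
under eq_Rintegral do rewrite mul0r subr0.
pose h (xi : R) := `|xi| * (gauss_mass a * pgauss 1 a^-1 xi) * cos (x * xi).
have gm := gauss_mass_gt0 a a0.
rewrite (Rintegral_fold h (gauss_mass a * C)).
- rewrite /osc -RintegralZl//; last exact: integrable_pgauss_cos.
  apply: eq_Rintegral => y; rewrite inE /= in_itv /= andbT => y0.
  rewrite /h normrN (ger0_norm y0) pgauss1N mulrN cosN addr0 /pgauss hornerX -polyC1 hornerC.
  by ring.
- move=> y; apply: cvgM.
    apply: cvgM; first by apply: cvg_norm; exact: cvg_id.
    by apply: cvgM; [exact: cvg_cst|exact: continuous_pgauss].
  apply: (@continuous_comp _ _ _ (fun y => x * y) cos); last exact: continuous_cos.
  by apply: cvgM; [exact: cvg_cst|exact: cvg_id].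
- move=> y; rewrite /h normrM (le_trans (ler_piMr _ (normr_cos_le1 _)))//.
  move: (HC y); rewrite /pgauss hornerX -polyC1 hornerC mul1r !normrM normr_id (gtr0_norm gm).
  by move=> H; rewrite mulrCA -[leRHS]mulrA ler_pM2l.
Qed.

End gaussian_half_laplacian.

(** * Testing the equation against Gaussians *)

Section testing_with_gaussians.
Context {R : realType}.
Local Notation mu := (@lebesgue_measure R).
Local Open Scope classical_set_scope.

Lemma L_half_measurable (u : R -> R) : L_half u -> measurable_fun setT u.
Proof. by case => -[]. Qed.

Lemma integrable_L_half (u h : R -> R) (C : R) : L_half u ->
  measurable_fun setT h -> (forall x, `|h x| <= C / oneDsqr x) ->
  mu.-integrable setT (EFin \o (fun x => u x * h x)).
Proof.
move=> uL mh hC; have mu_ := L_half_measurable u uL.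
have [_ ui] := uL.
have mD : measurable_fun setT (fun x : R => (oneDsqr x)^-1).
  by apply: continuous_measurable_fun; exact: continuous_oneDsqrV.
have ii : mu.-integrable setT (EFin \o (fun x => `|u x| / oneDsqr x)).
  apply/integrableP; split.
    by apply/measurable_EFinP; apply: measurable_funM => //; exact: measurableT_comp.
  by under eq_integral do rewrite /= ger0_norm ?divr_ge0//.
apply: (le_integrable _ _ _ (integrable_scale _ C _ _ ii)) => //.
  by apply/measurable_EFinP; exact: measurable_funM.
move=> x _ /=; rewrite lee_fin normrM mulrCA normrM normr_id.
by rewrite ler_wpM2l// (le_trans (hC x))// ler_norm.
Qed.

Lemma Rintegral_ae_le0 (f : R -> R) : measurable_fun setT f ->
  {ae mu, forall x, f x <= 0} -> \int[mu]_x f x <= 0.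
Proof.
move=> mf f0; rewrite /Rintegral integralE.
rewrite (_ : (\int[mu]_x _^\+ x = 0)%E) ?sub0e.
  by rewrite fine_le0// oppe_le0 integral_ge0.
rewrite -(integral0 mu setT); apply: ae_eq_integral => //.
  by apply: measurable_funepos; exact/measurable_EFinP.
have [N [mN N0 fN]] := f0; exists N; split=> // x /= fx; apply: fN => /= fx0.
by apply: fx => _; rewrite funeposE max_r.
Qed.

Lemma schwartz_gauss (a : R) : 0 < a -> schwartz (fun x => (pgauss 1 a x)%:C%C).
Proof.
move=> a0; split; first exact: schwartz_pgauss.
rewrite (_ : (fun x => _) = pgauss 0 a); first exact: schwartz_pgauss.
by apply/funext => x; rewrite /pgauss horner0 mul0r.
Qed.

(** The only consequence of the equation that is used; it holds because the
    Gaussian with parameter [1 / b] is a nonnegative test function. *)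
Lemma half_laplacian_le0_kernel (K u : R -> R) (b : R) :
  measurable_fun setT K -> {ae mu, forall x, K x <= 0} -> L_half u ->
  distribution_eq (half_laplacian u) (fun_distribution (fun x => K x * expR (u x))) ->
  0 < b -> \int[mu]_x (u x * osc 'X b 0 x) <= 0.
Proof.
move=> mK K0 uL eqd b0; have mu_ := L_half_measurable u uL.
pose a := b^-1; have a0 : 0 < a by rewrite invr_gt0.
have ReM (r : R) (z : complex R) : complex.Re (r%:C%C * z) = r * complex.Re z.
  by case: z => z1 z2 /=; rewrite mul0r subr0.
have {}eqd : \int[mu]_x (half_laplacian_const a * (u x * osc 'X b 0 x)) =
    \int[mu]_x (K x * expR (u x) * pgauss 1 a x).
  have := congr1 (@complex.Re R) (eqd _ (schwartz_gauss a a0)).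
  rewrite /half_laplacian /fun_distribution /Cintegral => eqd'.
  transitivity (\int[mu]_x complex.Re ((u x)%:C%C *
      half_laplacian_schwartz (fun x => (pgauss 1 a x)%:C%C) x)).
    by apply: eq_Rintegral => x _; rewrite ReM half_laplacian_gauss// invrK mulrCA.
  by apply: etrans eqd' _; apply: eq_Rintegral => x _; rewrite ReM.
have [C HC] := oscX_cos_decay b b0.
have mosc : measurable_fun setT (osc 'X b 0).
  apply: continuous_measurable_fun.
  exact: (is_derive_continuous _ _ (fun x => is_derive_osc 'X b 0 x b0)).
rewrite RintegralZl// in eqd; last exact: (integrable_L_half _ _ C).
have c0 : 0 < half_laplacian_const a.
  by rewrite /half_laplacian_const mulr_gt0 ?invr_gt0 ?mulr_gt0 ?pi_gt0 ?gauss_mass_gt0.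
rewrite -(pmulr_rle0 _ c0) eqd; apply: Rintegral_ae_le0.
  apply: measurable_funM; last first.
    by apply: continuous_measurable_fun; exact: continuous_pgauss.
  apply: measurable_funM => //; exact: measurableT_comp.
have [N [mN N0 KN]] := K0; exists N; split=> // x /= fx; apply: KN => /= Kx; apply: fx.
by rewrite pgauss1E mulr_le0_ge0 ?expR_ge0// mulr_le0_ge0 ?expR_ge0.
Qed.

End testing_with_gaussians.

(** * The Dawson function and its kernel *)

Section dawson_kernel.
Context {R : realType}.
Local Notation mu := (@lebesgue_measure R).
Local Open Scope classical_set_scope.
Implicit Types (b t x y : R).

(** The function [\int_0^oo exp (- y^2 / 2) sin (x y) dy], a rescaling of the
    classical Dawson function, and its derivative. *)
Definition dawson : R -> R := osc 1 1 (- (pi / 2)).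
Definition dawson' : R -> R := osc 'X 1 0.

Lemma is_derive_dawson x : is_derive x 1 dawson (dawson' x).
Proof. exact: is_derive_osc1_sin. Qed.

Lemma dawson'E x : dawson' x = 1 - x * dawson x.
Proof. by rewrite -oscX_cosE// mul1r. Qed.

Lemma osc1_sin0 b : osc 1 b (- (pi / 2)) 0 = 0.
Proof.
rewrite /osc; under eq_Rintegral do rewrite mul0r add0r cosN cos_pihalf mulr0.
by rewrite Rintegral_cst// mul0r.
Qed.

(** Both sides solve [t^2 S' = 1 - x S] with [S 0 = 0]; hence their difference,
    multiplied by [exp (x^2 / (2 t^2))], is constant. *)
Lemma osc1_sin_scaling t x : 0 < t ->
  osc 1 (t ^+ 2) (- (pi / 2)) x = t^-1 * dawson (x / t).
Proof.
move=> t0; have tN : t != 0 by rewrite gt_eqF.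
have b0 : 0 < t ^+ 2 by rewrite exprn_gt0.
pose E y : R := expR (y ^+ 2 / (2 * t ^+ 2)).
have dE y : is_derive y 1 E (E y * (y / t ^+ 2)).
  apply: (@is_derive1_comp _ expR (fun y => y ^+ 2 / (2 * t ^+ 2)) y).
  by apply: is_derive_eq; rewrite /GRing.scale /=; field.
pose F y := E y * (osc 1 (t ^+ 2) (- (pi / 2)) y - t^-1 * dawson (y / t)).
have F0 : F x = F 0.
  apply: (@is_derive_0_is_cst R) => y.
  have d1 := is_derive_osc1_sin (t ^+ 2) y b0.
  have d2 : is_derive y 1 (fun y => dawson (y / t)) (dawson' (y / t) * t^-1).
    apply: (@is_derive1_comp _ dawson (fun y => y / t) y).
      exact: is_derive_dawson.
    by apply: is_derive_eq; rewrite /GRing.scale /=; ring.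
  have H : osc 'X (t ^+ 2) 0 y = (1 - y * osc 1 (t ^+ 2) (- (pi / 2)) y) / t ^+ 2.
    by rewrite -oscX_cosE// mulrAC divff ?mul1r// gt_eqF.
  by apply: is_derive_eq; rewrite /GRing.scale /= H dawson'E; field.
apply/eqP; rewrite -subr_eq0; apply/eqP.
apply: (mulfI (x := E x)); first by rewrite gt_eqF ?expR_gt0.
by rewrite mulr0 -/(F x) F0 /F osc1_sin0 mul0r /dawson osc1_sin0 mulr0 subr0 mulr0.
Qed.

Lemma oscX_cos_scaling t x : 0 < t ->
  osc 'X (t ^+ 2) 0 x = t ^- 2 * dawson' (x / t).
Proof.
move=> t0; have tN : t != 0 by rewrite gt_eqF.
have b0 : 0 < t ^+ 2 by rewrite exprn_gt0.
have H := oscX_cosE (t ^+ 2) x b0; rewrite osc1_sin_scaling// in H.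
rewrite dawson'E; apply: (mulfI (x := t ^+ 2)); first by rewrite gt_eqF.
by rewrite H; field.
Qed.

(** A nondecreasing function vanishing at the origin has the sign of its
    argument. *)
Lemma ge0_derive_mul_ge0 (f df : R -> R) : f 0 = 0 ->
  (forall x : R, is_derive x 1 f (df x)) -> (forall x, 0 <= df x) ->
  forall x, 0 <= x * f x.
Proof.
move=> f0 fdf df0 x.
have cf := is_derive_continuous _ _ fdf.
have [||c _ fE] := @MVT_segment R f df (Num.min x 0) (Num.max x 0) _ (fun y _ => fdf y).
- by rewrite ge_min le_max lexx.
- exact: continuous_subspaceT.
- have [x0|x0] := leP 0 x.
    move: fE; rewrite min_r// max_l// f0 !subr0 => ->.
    by rewrite mulrCA mulr_ge0// -expr2 sqr_ge0.
  move: fE; rewrite min_l ?max_r ?(ltW x0)// f0 => fE.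
  have -> : f x = df c * x by lra.
  by rewrite mulrCA mulr_ge0// -expr2 sqr_ge0.
Qed.

(** Comparison of [exp (x^2 / 2) * D x] with [x]. *)
Lemma dawson_ge x : x ^+ 2 * expR (- (x ^+ 2 / 2)) <= x * dawson x.
Proof.
pose E y : R := expR (y ^+ 2 / 2).
have dE y : is_derive y 1 E (E y * y).
  apply: (@is_derive1_comp _ expR (fun y => y ^+ 2 / 2) y).
  by apply: is_derive_eq; rewrite /GRing.scale /=; field.
have := ge0_derive_mul_ge0 (fun y => E y * dawson y - y) (fun y => E y - 1).
have d0 : E 0 * dawson 0 - 0 = 0 by rewrite /dawson osc1_sin0 mulr0 subr0.
have dd y : is_derive y 1 (fun y => E y * dawson y - y) (E y - 1).
  have dD := is_derive_dawson y.
  by apply: is_derive_eq; rewrite /GRing.scale /= dawson'E; ring.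
have dp y : 0 <= E y - 1.
  by rewrite subr_ge0 (le_trans _ (expR_ge1Dx _))// lerDl divr_ge0// sqr_ge0.
move=> /(_ d0 dd dp x); rewrite mulrBr -expr2 subr_ge0 => H.
by rewrite expRN ler_pdivrMr ?expR_gt0// -/(E x) mulrAC -mulrA.
Qed.

Lemma dawson_le : exists M, 1 <= M /\ forall x, x * dawson x <= M * x ^+ 2.
Proof.
have [C HC] := osc_bounded 'X (1 : R) ltr01; exists (Num.max 1 C).
split; first by rewrite le_max lexx.
set M := Num.max 1 C => x.
have := ge0_derive_mul_ge0 (fun y => M * y - dawson y) (fun y => M - dawson' y).
have d0 : M * 0 - dawson 0 = 0 by rewrite /dawson osc1_sin0 mulr0 subr0.
have dd y : is_derive y 1 (fun y => M * y - dawson y) (M - dawson' y).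
  have dD := is_derive_dawson y.
  by apply: is_derive_eq; rewrite /GRing.scale /=; ring.
have dp y : 0 <= M - dawson' y.
  by rewrite subr_ge0 (le_trans (ler_norm _))// (le_trans (HC _ _))// le_max lexx orbT.
move=> /(_ d0 dd dp x); rewrite mulrBr subr_ge0 => /le_trans; apply.
by rewrite mulrCA expr2.
Qed.

(** The value at the origin is the limit of [D (x / t) / x], so that the formula
    for the derivative in [t] holds at every [x]. *)
Definition dawson_kernel t x : R :=
  if x == 0 then t^-1 else dawson (x / t) / x.

Lemma is_derive_dawson_kernel t x : 0 < t ->
  is_derive t 1 (dawson_kernel^~ x) (- osc 'X (t ^+ 2) 0 x).
Proof.
move=> t0; have tN : t != 0 by rewrite gt_eqF.
have dV : is_derive t 1 (fun t : R => t^-1) (- t ^- 2).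
  by have := @is_deriveV R id t 1 1 tN (is_derive_id _ _); rewrite /GRing.scale /= mulr1.
rewrite oscX_cos_scaling// /dawson_kernel; have [->|xN] := eqVneq x 0.
  by rewrite mul0r dawson'E mul0r subr0 mulr1.
have dD : is_derive t 1 (fun t => dawson (x / t)) (dawson' (x / t) * (- (x / t ^+ 2))).
  apply: (@is_derive1_comp _ dawson (fun t => x / t) t).
    exact: is_derive_dawson.
  by apply: is_derive_eq; rewrite /GRing.scale /=; ring.
by apply: is_derive_eq; rewrite /GRing.scale /=; field; rewrite xN tN.
Qed.

Lemma measurable_dawson_kernel t : measurable_fun setT (dawson_kernel t).
Proof.
apply: measurable_fun_if => //; first exact: measurable_fun_eqr.
rewrite setTI (_ : _ @^-1` _ = [set x | x != 0]); last first.
  by apply/seteqP; split => x /=; [move=> ->|move/negbTE].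
apply: open_continuous_measurable_fun; first exact: open_neq.
move=> x; rewrite inE /= => x0; apply: cvgM; last exact: cvgV.
apply: (@continuous_comp _ _ _ (fun x => x / t) dawson).
  by apply: cvgM; [exact: cvg_id|exact: cvg_cst].
exact: (is_derive_continuous _ _ is_derive_dawson).
Qed.

Lemma dawson_kernel_gauss_ge t x : 0 < t ->
  expR (- ((x / t) ^+ 2 / 2)) / t <= dawson_kernel t x.
Proof.
move=> t0; have tN : t != 0 by rewrite gt_eqF.
rewrite /dawson_kernel; have [->|xN] := eqVneq x 0.
  by rewrite mul0r expr0n /= mul0r oppr0 expR0 mul1r.
have x2 : 0 < x ^+ 2 by rewrite exprn_even_gt0.
have := dawson_ge (x / t); set e := expR _; set D := dawson _ => H.
rewrite -(ler_pM2l (divr_gt0 x2 t0)).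
rewrite (_ : x ^+ 2 / t * (e / t) = (x / t) ^+ 2 * e); last by field; rewrite ?xN ?tN.
by rewrite (_ : x ^+ 2 / t * (D / x) = x / t * D)//; field; rewrite xN tN.
Qed.

Lemma dawson_kernel_ge0 t x : 0 < t -> 0 <= dawson_kernel t x.
Proof.
move=> t0; apply: le_trans (dawson_kernel_gauss_ge _ _ t0).
by rewrite divr_ge0 ?expR_ge0 ?ltW.
Qed.

Lemma dawson_kernel_le : exists M, 0 < M /\ forall t x, 0 < t -> dawson_kernel t x <= M / t.
Proof.
have [M [M1 HM]] := dawson_le; have M0 : 0 < M by exact: lt_le_trans M1.
exists M; split=> // t x t0; have tN : t != 0 by rewrite gt_eqF.
rewrite /dawson_kernel; have [_|xN] := eqVneq x 0.
  by rewrite ler_peMl// invr_ge0 ltW.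
have x2 : 0 < x ^+ 2 by rewrite exprn_even_gt0.
have := HM (x / t); set D := dawson _ => H.
rewrite -(ler_pM2l (divr_gt0 x2 t0)).
rewrite (_ : x ^+ 2 / t * (M / t) = M * (x / t) ^+ 2); last by field.
by rewrite (_ : x ^+ 2 / t * (D / x) = x / t * D)//; field; rewrite xN tN.
Qed.

Lemma dawson_kernel_decay t : 0 < t ->
  exists C, forall x, `|dawson_kernel t x| <= C / oneDsqr x.
Proof.
move=> t0; have [M [M0 HM]] := dawson_kernel_le.
have [C HC] := osc_bounded 'X (1 : R) ltr01.
exists (M / t + t * (1 + C)) => x; have tN : t != 0 by rewrite gt_eqF.
rewrite ger0_norm ?dawson_kernel_ge0// ler_pdivlMr ?oneDsqr_gt0// mulrDr mulr1 lerD ?HM//.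
have -> : dawson_kernel t x * x ^+ 2 = t * (1 - dawson' (x / t)).
  rewrite /dawson_kernel dawson'E; have [->|xN] := eqVneq x 0.
    by rewrite !mul0r subr0 subrr mulr0 expr0n mulr0.
  by field; rewrite xN tN.
rewrite ler_pM2l// lerD2l (le_trans (ler_norm _))// normrN; exact: HC.
Qed.

End dawson_kernel.

(** * Monotonicity and decay of the averages *)

Section averages.
Context {R : realType}.
Local Notation mu := (@lebesgue_measure R).
Local Open Scope classical_set_scope.
Implicit Types (u : R -> R) (s t x : R).

(** The average of [u] at scale [t], for a kernel whose mass is
    independent of [t] but not normalized. *)
Definition dawson_average u t : R := \int[mu]_x (u x * dawson_kernel t x).

Lemma integrable_dawson_average u t : L_half u -> 0 < t ->
  mu.-integrable setT (EFin \o (fun x => u x * dawson_kernel t x)).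
Proof.
move=> uL t0; have [C HC] := dawson_kernel_decay t t0.
by apply: (integrable_L_half _ _ C) => //; exact: measurable_dawson_kernel.
Qed.

(** The bound [1 / 2] keeps [t] away from [0], where the derivative of the
    kernel is not uniformly bounded. *)
Lemma is_derive_dawson_average u t : L_half u -> 1 / 2 < t ->
  is_derive t 1 (dawson_average u)
    (- \int[mu]_x (u x * osc 'X (t ^+ 2) 0 x)).
Proof.
move=> uL t2; have [C HC] := @oscX_cos_decay R 1 ltr01.
have tpos (z : R) : 1 / 2 < z -> 0 < z by apply: lt_trans; rewrite divr_gt0.
have C0 : 0 <= C.
  by have := le_trans (normr_ge0 _) (HC 0); rewrite /oneDsqr expr0n/= addr0 invr1 mulr1.
have decay z x : 1 / 2 < z -> `|osc 'X (z ^+ 2) 0 x| <= 4 * C / oneDsqr x.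
  move=> z2; have z0 := tpos z z2; have zN : z != 0 by rewrite gt_eqF.
  rewrite oscX_cos_scaling// normrM ger0_norm ?invr_ge0 ?sqr_ge0//.
  apply: (le_trans (ler_wpM2l _ (HC (x / z)))); first by rewrite invr_ge0 sqr_ge0.
  have n0 : 0 < z ^+ 2 + x ^+ 2 by rewrite ltr_pwDl ?exprn_gt0 ?sqr_ge0.
  rewrite (_ : z ^- 2 * (C / _) = C / (z ^+ 2 + x ^+ 2)); last first.
    by rewrite /oneDsqr; field; rewrite zN gt_eqF.
  rewrite ler_pdivrMr// mulrAC ler_pdivlMr ?oneDsqr_gt0// (mulrC 4 C) -mulrA ler_wpM2l//.
  rewrite /oneDsqr; have : (1 / 2) ^+ 2 <= z ^+ 2 by rewrite lerXn2r ?nnegrE ?divr_ge0 ?ltW.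
  by have := sqr_ge0 x; lra.
have cosc z : 0 < z -> measurable_fun setT (osc 'X z 0 : R -> R).
  move=> z0; apply: continuous_measurable_fun.
  exact: (is_derive_continuous _ _ (fun x => is_derive_osc 'X z 0 x z0)).
rewrite -mulN1r -RintegralZl//; last first.
  apply: (integrable_L_half _ _ (4 * C)) => //; last by move=> x; exact: decay.
  by apply: cosc; rewrite exprn_gt0// tpos.
apply: (is_derive_under_integral _ (fun t x => u x * dawson_kernel t x)
   (fun t x => -1 * (u x * osc 'X (t ^+ 2) 0 x)) t (1 / 2) (t + 1)
   (fun x => `|u x| * (4 * C / oneDsqr x))) => //.
- by rewrite t2 ltrDl ltr01.
- by move=> z /andP[z2 _]; apply: integrable_dawson_average => //; exact: tpos.
- move=> z x /andP[z2 _]; have dk := is_derive_dawson_kernel z x (tpos z z2).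
  by apply: is_derive_eq; rewrite /GRing.scale /=; ring.
- by move=> x; rewrite mulr_ge0 ?divr_ge0 ?mulr_ge0.
- have mD : measurable_fun setT (fun x : R => 4 * C / oneDsqr x).
    apply: measurable_funM => //; apply: continuous_measurable_fun.
    exact: continuous_oneDsqrV.
  have gD x : `|4 * C / oneDsqr x| <= 4 * C / oneDsqr x.
    by rewrite ger0_norm ?divr_ge0 ?mulr_ge0.
  have := integrable_norm (integrable_L_half _ _ _ uL mD gD); apply: eq_integrable => //.
  by move=> x _ /=; rewrite normrM [`|_ / _|]ger0_norm ?divr_ge0 ?mulr_ge0.
- move=> z x /andP[z2 _]; rewrite mulN1r normrN normrM ler_wpM2l//; exact: decay.
Qed.

Lemma dawson_average_nondecreasing u t : L_half u ->
  (forall b, 0 < b -> \int[mu]_x (u x * osc 'X b 0 x) <= 0) ->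
  1 <= t -> dawson_average u 1 <= dawson_average u t.
Proof.
move=> uL H t1.
have dU x : x \in `]1 / 2, +oo[%R ->
    is_derive x 1 (dawson_average u) (- \int[mu]_y (u y * osc 'X (x ^+ 2) 0 y)).
  by rewrite in_itv /= andbT; exact: is_derive_dawson_average.
apply: (@ger0_derive1_ndecry R (dawson_average u) 1) => //.
- move=> x; rewrite in_itv /= andbT => x1.
  by case: (is_derive_dawson_average u x uL (lt_trans _ x1)) => //; lra.
- move=> x; rewrite in_itv /= andbT => x1; rewrite derive1E.
  have x2 : 1 / 2 < x by lra.
  case: (is_derive_dawson_average u x uL x2) => _ ->.
  by rewrite oppr_ge0 H// exprn_gt0//; lra.
- apply: derivable_within_continuous => x; rewrite in_itv /= andbT => x1.
  have x2 : 1 / 2 < x by lra.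
  by case: (is_derive_dawson_average u x uL x2).
Qed.

(** The constant [A] is proportional to the integral of [e^u], and [d] is the
    lower bound of the kernel at unit scale. *)
Lemma dawson_average_le u : L_half u ->
  (\int[mu]_x (expR (u x))%:E < +oo)%E ->
  exists A d, 0 <= A /\ 0 < d /\ forall s t, 0 <= s -> 0 < t ->
    dawson_average u t <= expR s * A / t - s * d.
Proof.
move=> uL ei; have mu_ := L_half_measurable u uL.
have [M [M0 HM]] := @dawson_kernel_le R.
have ie : mu.-integrable setT (EFin \o (fun x => expR (u x))).
  apply/integrableP; split.
    by apply/measurable_EFinP; exact: measurableT_comp.
  by under eq_integral do rewrite /= ger0_norm ?expR_ge0//.
pose I := \int[mu]_x expR (u x).
have I0 : 0 <= I by apply: Rintegral_ge0 => x _; exact: expR_ge0.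
exists (expR (-1) * M * I), (expR (- (1 / 2))).
split; first by rewrite !mulr_ge0 ?expR_ge0// ltW.
split; first exact: expR_gt0.
move=> s t s0 t0; set d := expR (- (1 / 2)).
have i1 := integrable_scale _ (expR (s - 1) * (M / t)) _ measurableT ie.
have i2 := integrable_scale _ (- s * (d / t)) _ measurableT (integrable_indic0 t).
rewrite [leRHS](_ : _ = \int[mu]_x (expR (s - 1) * (M / t) * expR (u x) +
    - s * (d / t) * \1_`[0%R, t] x)); last first.
  rewrite RintegralD// !RintegralZl ?integrable_indic0// Rintegral_indic0 ?ltW//.
  by rewrite expRD -/I; field; rewrite gt_eqF.
apply: le_Rintegral => //; first exact: integrable_dawson_average.
  by have := integrableD measurableT i1 i2; apply: eq_integrable.
move=> x _; have w0 := dawson_kernel_ge0 t x t0; have wM := HM t x t0.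
have wd : d / t * \1_`[0%R, t] x <= dawson_kernel t x.
  rewrite indicE; case: (boolP (x \in _)) => xt; last by rewrite mulr0.
  rewrite mulr1 (le_trans _ (dawson_kernel_gauss_ge t x t0))// ler_pM2r ?invr_gt0//.
  rewrite ler_expR lerN2 ler_pM2r ?invr_gt0//.
  move: xt; rewrite inE /= in_itv /= => /andP[x0 xt].
  by rewrite expr_le1 ?divr_ge0 ?(ltW t0)// ler_pdivrMr// mul1r.
(* [1 + z <= e^z] at [z = u x + s - 1]. *)
have ue : u x <= expR (s - 1) * expR (u x) - s.
  by rewrite -expRD; have := expR_ge1Dx (s - 1 + u x); lra.
apply: (le_trans (ler_wpM2r w0 ue)); rewrite mulrBl lerD//.
  by rewrite mulrAC ler_wpM2r ?expR_ge0// ler_wpM2l ?expR_ge0.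
by rewrite -mulrA -[leLHS]mulNr ler_wnM2l// oppr_le0.
Qed.

End averages.

(** * The nonexistence result *)

Theorem proposition1p1 (R : realType) (K : R -> R)
    (hK : K \in Lfun (@lebesgue_measure R) +oo%E)
    (hK0 : {ae @lebesgue_measure R, forall x, K x <= 0}) :
  ~ exists u : R -> R,
      [/\ L_half u,
          (\int[@lebesgue_measure R]_x (expR (u x))%:E < +oo)%E
        & distribution_eq (half_laplacian u)
            (fun_distribution (fun x => K x * expR (u x)))].
Proof.
move=> [u [uL ei eqd]].
have mK : measurable_fun setT K.
  by have := sub_Lfun_mfun hK; rewrite inE.
have H b (b0 : 0 < b) := half_laplacian_le0_kernel K u b mK hK0 uL eqd b0.
have [A [d [A0 [d0 UA]]]] := dawson_average_le u uL ei.
set U1 := dawson_average u 1.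
(* This [s] makes [s d] exceed [|U 1|] by one, and [t] makes [e^s A / t] smaller
   than one. *)
pose s := (`|U1| + 1) / d; have s0 : 0 <= s by rewrite divr_ge0 ?addr_ge0// ltW.
pose t := expR s * A + 1; have t1 : 1 <= t by rewrite lerDr mulr_ge0 ?expR_ge0.
have t0 : 0 < t by lra.
have := le_trans (dawson_average_nondecreasing u t uL H t1) (UA s t s0 t0).
rewrite -/U1 (_ : s * d = `|U1| + 1); last by rewrite /s; field; rewrite gt_eqF.
have : expR s * A / t < 1 by rewrite ltr_pdivrMr// mul1r /t ltrDl.
have := ler_norm (- U1); rewrite normrN; lra.
Qed.
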